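(* Let $p\in(0,1]$, $\theta>0$, $\phi(x)=\|x\|_p^p=\sum_{i=1}^n|x_i|^p$ and $\Theta=\{x\in\mathbb{R}^n\mid\phi(x)\le\theta\}$. For any $\bar x\in\Theta$, with $\bar{\mathcal N}=\{i\mid\bar x_i\ne0\}$, it holds that $N_\Theta(\bar x)=\mathrm{pos}\,\partial\phi(\bar x)\cup\partial^\infty\phi(\bar x)$, i.e., $$N_\Theta(\bar x)=\begin{cases}\{v\in\mathbb{R}^n\mid v_j=\lambda\,\mathrm{sign}(\bar x_j)\,p\,|\bar x_j|^{p-1},\ j\in\bar{\mathcal N};\ \lambda\ge0\}&\text{if }\bar x\in\partial\Theta,\\ \{0\}&\text{if }\bar x\in\mathrm{int}\,\Theta.\end{cases}$$ (In the first case the set consists of all $v$ for which there is some $\lambda\ge0$ such that the equalities hold for all $j\in\bar{\mathcal N}$.) Furthermore, $\Theta$ is Clarke regular at any $\bar x\in\Theta$, i.e., $\widehat N_\Theta(\bar x)=N_\Theta(\bar x)$.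
   Context: For $C\subset\mathbb{R}^n$ and $\bar x\in C$: $v\in\widehat N_C(\bar x)$ (regular normal) if $\limsup_{x\to\bar x,\,x\in C,\,x\ne\bar x}\langle v,x-\bar x\rangle/\|x-\bar x\|\le0$; $v\in N_C(\bar x)$ (general normal) if there are $x^\nu\in C$, $x^\nu\to\bar x$ and $v^\nu\in\widehat N_C(x^\nu)$ with $v^\nu\to v$. $C$ is Clarke regular at $\bar x$ if it is locally closed at $\bar x$ and $N_C(\bar x)=\widehat N_C(\bar x)$. $\mathrm{int}\,\Theta$ and $\partial\Theta$ are the interior and boundary of $\Theta$. The positive hull is $\mathrm{pos}\,C=\{0\}\cup\{\lambda x\mid x\in C,\ \lambda>0\}$. Subgradients of $\phi$: $v\in\widehat\partial\phi(\bar x)$ (regular subgradient) if $\phi(x)\ge\phi(\bar x)+\langle v,x-\bar x\rangle+o(|x-\bar x|)$; $v\in\partial\phi(\bar x)$ (general subgradient) if there are $x^\nu\to\bar x$ with $\phi(x^\nu)\to\phi(\bar x)$ and $v^\nu\in\widehat\partial\phi(x^\nu)$ with $v^\nu\to v$; $v\in\partial^\infty\phi(\bar x)$ (horizon subgradient) if there are $x^\nu\to\bar x$ with $\phi(x^\nu)\to\phi(\bar x)$, $v^\nu\in\widehat\partial\phi(x^\nu)$ and $\lambda^\nu\searrow0$ with $\lambda^\nu v^\nu\to v$.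
   Formalization: False as printed for p=1 with some x̄_j=0 (n=2, θ=1, x̄=(1,0), v=(0,1)) and, for N=pos∂φ∪∂^∞φ, in int Θ. Proved instead: for p=1 the boundary cone also requires |v_j|≤λ where x̄_j=0, and the subgradient formula is stated only for x̄∈∂Θ. *)

(* Defs.v *)
From HB Require Import structures.
From mathcomp Require Import all_boot all_order all_algebra.
From mathcomp Require Import all_classical all_reals all_analysis.
Export Order.TTheory GRing.Theory Num.Theory.
Export numFieldNormedType.Exports.

Set Implicit Arguments.
Unset Strict Implicit.
Unset Printing Implicit Defensive.

Local Open Scope classical_set_scope.
Local Open Scope ring_scope.

(* 'rV[R]_n carries the sup norm in the library.  The topology is that of R^n,
   but the Euclidean inner product and norm have to be defined. *)
Definition dotp (R : realType) (n : nat) (u v : 'rV[R]_n) : R :=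
  \sum_(i < n) u 0 i * v 0 i.

Definition enorm (R : realType) (n : nat) (u : 'rV[R]_n) : R :=
  Num.sqrt (dotp u u).

Definition boundary (T : topologicalType) (C : set T) : set T :=
  closure C `\` interior C.

(* If xbar is isolated in C, the filter is improper and the limsup is -oo. *)
Definition regular_normal_cone (R : realType) (n : nat)
    (C : set 'rV[R]_n) (xbar : 'rV[R]_n) : set 'rV[R]_n :=
  [set v | (limf_esup
              (fun x : 'rV[R]_n => (dotp v (x - xbar) / enorm (x - xbar))%:E)
              (within (C `\ xbar) (nbhs xbar)) <= 0)%E].

Definition normal_cone (R : realType) (n : nat)
    (C : set 'rV[R]_n) (xbar : 'rV[R]_n) : set 'rV[R]_n :=
  [set v | exists x_ v_ : nat -> 'rV[R]_n,
    [/\ forall k, C (x_ k),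
        x_ @ \oo --> xbar,
        forall k, regular_normal_cone C (x_ k) (v_ k) &
        v_ @ \oo --> v]].

Definition locally_closed_at (T : topologicalType) (C : set T) (x : T) : Prop :=
  exists V : set T, [/\ nbhs x V, closed V & closed (C `&` V)].

Definition clarke_regular (R : realType) (n : nat)
    (C : set 'rV[R]_n) (xbar : 'rV[R]_n) : Prop :=
  locally_closed_at C xbar /\
  normal_cone C xbar = regular_normal_cone C xbar.

Definition pos_hull (R : realType) (n : nat) (C : set 'rV[R]_n) :
    set 'rV[R]_n :=
  [set 0] `|` [set w | exists lambda x, [/\ 0 < lambda, C x & w = lambda *: x]].

Definition regular_subdiff (R : realType) (n : nat)
    (phi : 'rV[R]_n -> R) (xbar : 'rV[R]_n) : set 'rV[R]_n :=
  [set v | exists h : 'rV[R]_n -> R,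
    h =o_xbar (fun x : 'rV[R]_n => enorm (x - xbar)) /\
    forall x : 'rV[R]_n, phi xbar + dotp v (x - xbar) + h x <= phi x].

Definition subdiff (R : realType) (n : nat)
    (phi : 'rV[R]_n -> R) (xbar : 'rV[R]_n) : set 'rV[R]_n :=
  [set v | exists x_ v_ : nat -> 'rV[R]_n,
    [/\ x_ @ \oo --> xbar,
        phi (x_ k) @[k --> \oo] --> phi xbar,
        forall k, regular_subdiff phi (x_ k) (v_ k) &
        v_ @ \oo --> v]].

Definition horizon_subdiff (R : realType) (n : nat)
    (phi : 'rV[R]_n -> R) (xbar : 'rV[R]_n) : set 'rV[R]_n :=
  [set v | exists (x_ v_ : nat -> 'rV[R]_n) (lambda_ : nat -> R),
    [/\ x_ @ \oo --> xbar,
        phi (x_ k) @[k --> \oo] --> phi xbar,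
        forall k, regular_subdiff phi (x_ k) (v_ k),
        (forall k, 0 < lambda_ k) /\ lambda_ @ \oo --> 0 &
        lambda_ k *: v_ k @[k --> \oo] --> v]].

Definition lp_pow (R : realType) (n : nat) (p : R) (x : 'rV[R]_n) : R :=
  \sum_(i < n) `|x 0 i| `^ p.

Definition lp_ball (R : realType) (n : nat) (p theta : R) : set 'rV[R]_n :=
  [set x | lp_pow p x <= theta].

(* Main.v *)
Require Import Defs.
From HB Require Import structures.
From mathcomp Require Import all_boot all_order all_algebra.
From mathcomp Require Import all_classical all_reals all_analysis.
From mathcomp Require Import ring lra.
Import Order.TTheory GRing.Theory Num.Theory.
Import numFieldNormedType.Exports.

(** Write phi for the p-th power sum and Theta for its sublevel set at theta.
    By continuity and homogeneity of phi, the boundary of Theta is the level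
    set phi = theta and its interior is phi < theta.

    Everything rests on one explicit cone: the vectors v for which some l >= 0
    satisfies v_j = l * phi_j'(x_j) at the nonzero coordinates of x and, if
    p = 1, |v_j| <= l at the others ([lp_multiplier]).  At a boundary point this
    cone is the regular normal cone.
    - Its elements are regular normals.  If l = 1, then v is a regular
      subgradient of phi: at a nonzero coordinate because |t|^p is smooth there,
      at a zero coordinate because |t|^p has a cusp (p < 1) or a corner (p = 1)
      ([lp_multiplier_regular_subdiff]).  A nonnegative multiple of a regular
      subgradient is normal to the sublevel set, and l = 0 is a limit of
      positive multipliers ([lp_multiplier_regular_normal]).
    - Conversely, a regular normal is polar to every feasible direction.  As
      t^p is concave for p <= 1, phi lies below its tangent as long as the
      nonzero coordinates keep their sign and the others stay 0, so a direction
      supported where x is nonzero and orthogonal to the gradient is feasible.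
      Hence the normal is proportional to the gradient on the support.  If
      p = 1, moving a zero coordinate while descending along the gradient gives
      the remaining bounds ([regular_normal_lp_multiplier]).

    The cone is outer semicontinuous at x != 0, because a nonzero coordinate of
    x recovers l continuously from v ([lp_multiplier_closed]).  So limits of
    regular normals stay in it, which gives both the formula for the normal
    cone and Clarke regularity; the interior points among the approximating
    ones contribute only the normal 0.  The same semicontinuity controls the
    limits that define general and horizon subgradients, regular subgradients
    of phi at x being normal to the sublevel set through x.  Finally the
    positive multipliers yield the positive hull of the subgradients, and the
    multiplier 0 the horizon subgradients ([lp_multiplier_subgradient]). *)

Local Open Scope classical_set_scope.
Local Open Scope ring_scope.

(** * Euclidean inner product and norm *)

Section Euclidean.
Set Implicit Arguments.
Unset Strict Implicit.
Variables (R : realType) (n : nat).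
Implicit Types (u v w : 'rV[R]_n) (a : R).

Lemma dotpDl u v w : dotp (u + v) w = dotp u w + dotp v w.
Proof.
by rewrite /dotp -big_split/=; apply: eq_bigr => i _; rewrite !mxE mulrDl.
Qed.

Lemma dotpZl a u w : dotp (a *: u) w = a * dotp u w.
Proof.
by rewrite /dotp mulr_sumr; apply: eq_bigr => i _; rewrite !mxE mulrA.
Qed.

Lemma dotpC u v : dotp u v = dotp v u.
Proof. by apply: eq_bigr => i _; rewrite mulrC. Qed.

Lemma dotpDr u v w : dotp u (v + w) = dotp u v + dotp u w.
Proof. by rewrite dotpC dotpDl !(dotpC u). Qed.

Lemma dotpZr a u w : dotp u (a *: w) = a * dotp u w.
Proof. by rewrite dotpC dotpZl (dotpC u). Qed.

Lemma dotp0r u : dotp u 0 = 0.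
Proof. by rewrite -(scale0r u) dotpZr mul0r. Qed.

Lemma dotp_ge0 u : 0 <= dotp u u.
Proof. by apply: sumr_ge0 => i _; rewrite -expr2 sqr_ge0. Qed.

Lemma dotp_eq0 u : dotp u u = 0 -> u = 0.
Proof.
move=> /psumr_eq0P u0; apply/rowP => i; rewrite mxE.
have /eqP := u0 (fun i _ => sqr_ge0 (u 0 i)) i erefl.
by rewrite mulf_eq0 orbb => /eqP.
Qed.

Lemma enorm_ge0 u : 0 <= enorm u.
Proof. exact: sqrtr_ge0. Qed.

Lemma enorm0 : enorm (0 : 'rV[R]_n) = 0.
Proof. by rewrite /enorm dotp0r sqrtr0. Qed.

Lemma enorm_gt0 u : u != 0 -> 0 < enorm u.
Proof.
move=> u0; rewrite sqrtr_gt0 lt_neqAle dotp_ge0 andbT eq_sym.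
by apply: contra_neq u0 => /dotp_eq0.
Qed.

Lemma enormZ a u : 0 <= a -> enorm (a *: u) = a * enorm u.
Proof.
move=> a0; rewrite /enorm dotpZl dotpZr mulrA sqrtrM -?expr2 ?sqr_ge0//.
by rewrite sqrtr_sqr ger0_norm.
Qed.

Lemma coord_le_enorm u i : `|u 0 i| <= enorm u.
Proof.
rewrite -sqrtr_sqr /enorm ler_wsqrtr// /dotp (bigD1 i)//= expr2 lerDl.
by apply: sumr_ge0 => j _; rewrite -expr2 sqr_ge0.
Qed.

Lemma sum_coord_le_enorm u : \sum_(i < n) `|u 0 i| <= n%:R * enorm u.
Proof.
have -> : n%:R * enorm u = \sum_(i < n) enorm u.
  by rewrite sumr_const card_ord mulr_natl.
by apply: ler_sum => i _; exact: coord_le_enorm.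
Qed.

(** A weak form of Cauchy-Schwarz: only the fact that [dotp u w] is
    [O(enorm w)] for fixed [u] matters below, so the constant may be the
    1-norm of [u], which comes from a coordinatewise estimate. *)
Lemma dotp_le_enorm u w : `|dotp u w| <= (\sum_(i < n) `|u 0 i|) * enorm w.
Proof.
rewrite mulr_suml; apply: le_trans (ler_norm_sum _ _ _) _.
by apply: ler_sum => i _; rewrite normrM ler_wpM2l// coord_le_enorm.
Qed.

End Euclidean.

(** * Regular normals and regular subgradients in general *)

Section FirstOrder.
Set Implicit Arguments.
Unset Strict Implicit.
Variables (R : realType) (n : nat).
Implicit Types (C : set 'rV[R]_n) (phi : 'rV[R]_n -> R) (x v w : 'rV[R]_n).

(** The limsup condition in the form in which it is used.  The inequality is
    multiplied out by the norm, which makes the point [y = x] harmless and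
    covers an isolated [x] as well. *)
Lemma regular_normalP C x v :
  regular_normal_cone C x v <->
  forall e, 0 < e ->
    \forall y \near x, C y -> dotp v (y - x) <= e * enorm (y - x).
Proof.
split=> [|H].
  rewrite /regular_normal_cone/= /limf_esup => H e e0.
  have /ereal_inf_lt : (ereal_inf [set ereal_sup [set (dotp v (x0 - x) /
    enorm (x0 - x))%:E | x0 in V] | V in within (C `\ x) (nbhs x)] < e%:E)%E.
    by apply: le_lt_trans H _; rewrite lte_fin.
  move=> [_ [V xV <-]] Ve; rewrite /within/= in xV.
  near=> y => Cy; have [->|yx] := eqVneq y x.
    by rewrite subrr dotp0r enorm0 mulr0.
  rewrite -ler_pdivrMr ?enorm_gt0 ?subr_eq0// -lee_fin.
  apply: le_trans (ltW Ve); apply: ereal_sup_ubound; exists y => //.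
  have CV : (C `\ x) y -> V y by near: y.
  by apply: CV; split=> //; exact/eqP.
rewrite /regular_normal_cone/= /limf_esup; apply/lee_addgt0Pr => e e0.
rewrite add0e; apply: ge_ereal_inf; pose V := [set y |
  (C `\ x) y /\ dotp v (y - x) <= e * enorm (y - x)].
exists (ereal_sup [set (dotp v (y - x) / enorm (y - x))%:E | y in V]).
  exists V => //; rewrite /within/=.
  by apply: filterS (H _ e0) => y yle Cy; split=> //; apply: yle; exact: Cy.1.
apply: ge_ereal_sup => _ [y [[_ /eqP yx] yle] <-].
by rewrite lee_fin ler_pdivrMr// enorm_gt0 ?subr_eq0.
Unshelve. all: by end_near. Qed.

Lemma cvg_ray x w : x + t *: w @[t --> 0^'+] --> x.
Proof.
have : x + t *: w @[t --> 0^'+] --> x + 0 *: w.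
  apply: cvgD; first exact: cvg_cst.
  by apply: cvgZr_tmp; apply: cvg_at_right_filter; exact: cvg_id.
by rewrite scale0r addr0.
Qed.

(** Regular normals are polar to the feasible directions; all the upper
    bounds on normal cones below come from this. *)
Lemma regular_normal_feasible C x v w : regular_normal_cone C x v ->
  (\forall t \near 0^'+, C (x + t *: w)) -> dotp v w <= 0.
Proof.
move=> /regular_normalP vN Cw; apply/ler_addgt0Pr => e e0; rewrite add0r.
have d0 : 0 < enorm w + 1 by rewrite ltr_wpDl ?enorm_ge0.
have xt := @cvg_ray x w.
have /xt := vN _ (divr_gt0 e0 d0) => {}vN.
have [t [t0 Ct]] : exists t, [/\ 0 < t, C (x + t *: w) &
   C (x + t *: w) -> dotp v (x + t *: w - x) <=
      e / (enorm w + 1) * enorm (x + t *: w - x)].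
  near (0:R)^'+ => t; exists t; split.
  - by near: t; exact: nbhs_right_gt.
  - by near: t.
  - by near: t.
move=> /(_ Ct); rewrite [x + _]addrC addrK dotpZr enormZ ?(ltW t0)//.
rewrite mulrCA ler_pM2l//.
move=> /le_trans; apply; rewrite mulrAC ler_pdivrMr// ler_wpM2l ?ltW//.
by rewrite ltrDl.
Unshelve. all: by end_near. Qed.

(** For normals that are limits of multiples of subgradients without being such
    multiples themselves. *)
Lemma regular_normal_closed C x v :
  (forall e, 0 < e -> exists2 w, regular_normal_cone C x w &
     forall i, `|v 0 i - w 0 i| <= e) -> regular_normal_cone C x v.
Proof.
move=> H; apply/regular_normalP => e e0.
have d0 : 0 < n%:R + 1 :> R by rewrite ltr_wpDl ?ler0n.
have ed : 0 < e / (n%:R + 1) by rewrite divr_gt0.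
have [w wN vw] := H _ ed; move/regular_normalP : wN => /(_ _ ed).
apply: filterS => y + Cy => /(_ Cy) wy.
rewrite -[v](subrK w) dotpDl [leRHS](_ : _ = (n%:R * (e / (n%:R + 1))) *
  enorm (y - x) + e / (n%:R + 1) * enorm (y - x)); last by field; lra.
rewrite lerD// (le_trans (ler_norm _))// (le_trans (dotp_le_enorm _ _))//.
rewrite ler_wpM2r ?enorm_ge0//.
have -> : n%:R * (e / (n%:R + 1)) = \sum_(i < n) (e / (n%:R + 1)).
  by rewrite sumr_const card_ord mulr_natl.
by apply: ler_sum => i _; rewrite !mxE.
Qed.

(** The largest nonpositive error term that satisfies the minorant inequality,
    [Num.min 0 (phi y - phi x - dotp v (y - x))], serves as the witness [h]. *)
Lemma regular_subdiffP phi x v :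
  regular_subdiff phi x v <->
  forall e, 0 < e -> \forall y \near x,
    phi x + dotp v (y - x) <= phi y + e * enorm (y - x).
Proof.
split=> [[h [/eqoP ho hle]] e e0|H].
  near=> y; rewrite -lerBlDr (le_trans _ (hle y))// lerD2l lerNl.
  rewrite (le_trans (ler_norm _))// normrN.
  rewrite -[X in _ * X]ger0_norm ?enorm_ge0//.
  by near: y; exact: ho.
exists (fun y => Num.min 0 (phi y - (phi x + dotp v (y - x)))); split.
  apply/eqoP => e e0; apply: filterS (H _ e0) => y yle.
  rewrite (ger0_norm (enorm_ge0 _)) ler0_norm ?ge_min ?lexx//.
  rewrite lerNl le_min; apply/andP; split; last by lra.
  by rewrite oppr_le0 mulr_ge0 ?enorm_ge0 ?ltW.
by move=> y; rewrite -lerBrDl ge_min lexx orbT.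
Unshelve. all: by end_near. Qed.

(** On the sublevel set [phi y <= phi x] holds, so that a minorant of [phi] to
    first order turns into a bound from above on [dotp v (y - x)]. *)
Lemma regular_normal_sublevel phi a x v l : 0 <= l -> phi x = a ->
  regular_subdiff phi x v ->
  regular_normal_cone [set y | phi y <= a] x (l *: v).
Proof.
move=> l0 xa /regular_subdiffP vS; apply/regular_normalP => e e0.
have d0 : 0 < l + 1 by rewrite ltr_wpDl.
apply: filterS (vS _ (divr_gt0 e0 d0)) => y + /= ya; rewrite dotpZl => H.
have : dotp v (y - x) <= e / (l + 1) * enorm (y - x) by lra.
move=> /(ler_wpM2l l0)/le_trans; apply.
rewrite mulrA ler_wpM2r ?enorm_ge0// mulrCA ger_pMr//.
by rewrite ler_pdivrMr// mul1r lerDl.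
Qed.

Lemma regular_normal0 C x : regular_normal_cone C x 0.
Proof.
apply/regular_normalP => e e0; near=> y => _.
by rewrite dotpC dotp0r mulr_ge0 ?enorm_ge0 ?ltW.
Unshelve. all: by end_near. Qed.

(** The direction [v] itself is feasible, hence [dotp v v <= 0]. *)
Lemma regular_normal_interior C x v :
  interior C x -> regular_normal_cone C x v -> v = 0.
Proof.
move=> xC /regular_normal_feasible vN; apply/dotp_eq0/le_anti.
rewrite dotp_ge0 andbT; apply: vN.
by have xt := @cvg_ray x v; exact: xt.
Qed.

Lemma regular_normal_sub C x :
  C x -> regular_normal_cone C x `<=` normal_cone C x.
Proof.
move=> Cx v vN; exists (fun=> x), (fun=> v).
by split=> //; exact: cvg_cst.
Qed.

Lemma regular_subdiff_sub phi x : regular_subdiff phi x `<=` subdiff phi x.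
Proof.
move=> v vS; exists (fun=> x), (fun=> v).
by split=> //; exact: cvg_cst.
Qed.

End FirstOrder.

(** * The scalar function t |-> |t|^p *)

(** The derivative of [`|t| `^ p] at [t != 0].  As [Num.sg 0 = 0], its value at
    [0] is [0], so that the vector of slopes at a point has the support of the
    point. *)
Definition abs_slope {R : realType} (p t : R) : R :=
  Num.sg t * p * `|t| `^ (p - 1).

Section ScalarPower.
Set Implicit Arguments.
Unset Strict Implicit.
Variables (R : realType) (p : R).
Hypotheses (p_gt0 : 0 < p) (p_le1 : p <= 1).
Implicit Types (a b s t e : R).

(** Concavity of the power with exponent in (0, 1].  Dividing by [b] reduces it
    to Bernoulli's inequality [r `^ p <= 1 + p * (r - 1)], whose logarithm is a
    weighted arithmetic-geometric mean inequality. *)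
Lemma powR_le_tangent a b : 0 <= a -> 0 < b ->
  a `^ p <= b `^ p + p * b `^ (p - 1) * (a - b).
Proof.
move=> a0 b0; have bE := @mulr_powRB1 _ b p (ltW b0) p_gt0.
have B0 : 0 < b `^ (p - 1) by rewrite powR_gt0.
move: a0; rewrite le_eqVlt => /predU1P[<-|a0].
  rewrite powR0 ?gt_eqF// -bE sub0r.
  rewrite [leRHS](_ : _ = (1 - p) * (b * b `^ (p - 1))); last by ring.
  by rewrite mulr_ge0 ?subr_ge0// mulr_ge0// ltW.
set r := a / b; have r0 : 0 < r by rewrite divr_gt0.
have aE : a = r * b by rewrite /r divfK ?gt_eqF.
clearbody r; rewrite aE powRM ?(ltW r0) ?(ltW b0)// -bE.
rewrite [leRHS](_ : _ = (1 + p * (r - 1)) * (b * b `^ (p - 1))); last by ring.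
rewrite ler_wpM2r ?mulr_ge0 ?(ltW B0) ?(ltW b0)//.
(* [m] is the mean of [r] and [1] with weights [p] and [1 - p]: summing
   [ln z <= z - 1] at [z = r / m] and [z = 1 / m] with these weights leaves
   [0] on the right. *)
set m := 1 + p * (r - 1).
have m0 : 0 < m by have := mulr_gt0 p_gt0 r0; rewrite /m; move: p_le1; lra.
rewrite -ler_ln ?posrE ?powR_gt0// ln_powR.
have lnle (z : R) : 0 < z -> ln z <= z - 1.
  by move=> z0; rewrite -[z in ln z](subrKC 1); apply: le_ln1Dx; lra.
have h1 : p * ln (r / m) <= p * (r / m - 1).
  by rewrite ler_wpM2l ?(ltW p_gt0) ?lnle ?divr_gt0.
have h2 : (1 - p) * ln m^-1 <= (1 - p) * (m^-1 - 1).
  by rewrite ler_wpM2l ?subr_ge0 ?lnle ?invr_gt0 ?p_le1.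
have h3 : p * (r / m - 1) + (1 - p) * (m^-1 - 1) = 0.
  by rewrite /m; field; rewrite gt_eqF.
move: h1 h2; rewrite ln_div ?posrE// lnV ?posrE//; lra.
Qed.

Lemma abs_powR_continuous : continuous (fun t : R => `|t| `^ p).
Proof.
move=> t; have [->|t0] := eqVneq t 0.
  suff : `|s| `^ p @[s --> (0 : R)] --> (0 : R).
    by rewrite /continuous_at normr0 powR0 ?gt_eqF.
  apply/cvgr0Pnorm_lt => e e0.
  near=> s; rewrite ger0_norm ?powR_ge0//.
  have -> : e = (e `^ p^-1) `^ p by rewrite -powRrM mulVf ?gt_eqF// powRr1 ?ltW.
  apply: gt0_ltr_powR; rewrite ?nnegrE ?powR_ge0//.
  by near: s; apply: (@nbhs0_lt R R); rewrite powR_gt0.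
apply: (@continuous_comp _ _ _ (fun t : R => `|t|) (fun t => t `^ p)).
  exact: norm_continuous.
apply: differentiable_continuous; apply/derivable1_diffP.
by apply: derivable_powR; rewrite in_itv/= andbT normr_gt0.
Unshelve. all: by end_near. Qed.

Lemma powR_continuous_gt0 (q : R) t :
  0 < t -> {for t, continuous (fun s : R => s `^ q)}.
Proof.
move=> t0; apply: differentiable_continuous; apply/derivable1_diffP.
by apply: derivable_powR; rewrite in_itv/= andbT.
Qed.

Lemma sg_near t : t != 0 -> \forall s \near t, Num.sg s = Num.sg t.
Proof.
rewrite neq_lt => /orP[t0|t0]; near=> s.
  have s0 : s < 0 by near: s; exact: lt_nbhsl.
  by rewrite !ltr0_sg.
have s0 : 0 < s by near: s; exact: lt_nbhsr.
by rewrite !gtr0_sg.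
Unshelve. all: by end_near. Qed.

Lemma abs_slope_continuous t : t != 0 -> {for t, continuous (abs_slope p)}.
Proof.
move=> t0; apply: (@cvg_trans _ ((Num.sg t * p * `|s| `^ (p - 1)) @[s --> t])).
  apply: near_eq_cvg; apply: filterS (sg_near t0) => s st.
  by rewrite /abs_slope st.
have H : `|s| `^ (p - 1) @[s --> t] --> `|t| `^ (p - 1).
  apply: (@continuous_comp _ _ _ (fun t : R => `|t|) (fun t => t `^ (p - 1))).
    exact: norm_continuous.
  by apply: powR_continuous_gt0; rewrite normr_gt0.
exact: (cvgM (cvg_cst (Num.sg t * p)) H).
Qed.

(** The half line of points with the sign of [s] is where the function is
    concave; across [0] the inequality can fail. *)
Lemma abs_powR_le_tangent s t : s != 0 -> 0 <= Num.sg s * t ->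
  `|t| `^ p <= `|s| `^ p + abs_slope p s * (t - s).
Proof.
move=> s0 st; have := powR_le_tangent (normr_ge0 t) (_ : 0 < `|s|).
rewrite normr_gt0 => /(_ s0) /le_trans; apply; rewrite lerD2l /abs_slope.
have tE : `|t| = Num.sg s * t.
  by rewrite -(ger0_norm st) normrM normr_sg s0 mul1r.
set B := _ `^ (p - 1); rewrite tE normrEsg le_eqVlt; apply/orP; left; apply/eqP.
by rewrite /B; ring.
Qed.

(** Exchanging the roles of [s] and [t] in the tangent inequality gives a lower
    bound with the slope at [t] in place of the slope at [s]; by continuity of
    the slope the difference is absorbed in the error term. *)
Lemma abs_powR_lower s e : s != 0 -> 0 < e ->
  \forall t \near s,
    `|s| `^ p + abs_slope p s * (t - s) <= `|t| `^ p + e * `|t - s|.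
Proof.
move=> s0 e0.
have /cvgrPdist_le/(_ e e0) slope_near := abs_slope_continuous s0.
near=> t.
have sgt : Num.sg t = Num.sg s by near: t; exact: sg_near.
have t0 : t != 0 by rewrite -sgr_eq0 sgt sgr_eq0.
have : `|s| `^ p <= `|t| `^ p + abs_slope p t * (s - t).
  apply: abs_powR_le_tangent => //; by rewrite sgt -normrEsg.
have : (abs_slope p s - abs_slope p t) * (t - s) <= e * `|t - s|.
  apply: le_trans (ler_norm _) _; rewrite normrM ler_wpM2r//.
  by near: t.
lra.
Unshelve. all: by end_near. Qed.


(** At [0] the graph has a cusp for [p < 1], so that every slope is a
    subgradient, and a corner for [p = 1], where the slopes of the minorants
    range from -1 to 1. *)
Lemma abs_powR_lower0 (c : R) : (p = 1 -> `|c| <= 1) ->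
  \forall t \near (0 : R), c * t <= `|t| `^ p.
Proof.
move=> c1; move: p_le1; rewrite le_eqVlt => /predU1P[p1|p1].
  near=> t; rewrite p1 powRr1// (le_trans (ler_norm _))// normrM.
  by rewrite ler_piMl ?c1.
(* [d] solves [d `^ (p - 1) = `|c| + 1], and [p - 1] is a negative exponent. *)
pose d := (`|c| + 1) `^ (p - 1)^-1.
have c0 : 0 < `|c| + 1 by rewrite ltr_wpDl.
have d0 : 0 < d by rewrite powR_gt0.
near=> t; have [->|t0] := eqVneq t 0; first by rewrite mulr0 powR_ge0.
have tgt0 : 0 < `|t| by rewrite normr_gt0.
rewrite (le_trans (ler_norm _))// normrM mulrC -(@mulr_powRB1 _ `|t| p)//.
rewrite ler_pM2l//; apply: (@le_trans _ _ (`|c| + 1)); first by rewrite lerDl.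
have -> : `|c| + 1 = d `^ (p - 1).
  by rewrite -powRrM mulVf ?powRr1 ?ltW// subr_eq0 lt_eqF.
have td : `|t| <= d by near: t; apply: (@nbhs0_le R R).
clearbody d; rewrite -ler_ln ?posrE ?powR_gt0// !ln_powR.
by rewrite ler_wnM2l ?subr_le0 ?(ltW p1)// ler_ln ?posrE.
Unshelve. all: by end_near. Qed.


End ScalarPower.

(** * Multipliers *)

Lemma abs_slope_neq0 (R : realType) (p t : R) :
  0 < p -> t != 0 -> abs_slope p t != 0.
Proof.
move=> p0 t0; rewrite /abs_slope !mulf_neq0 ?sgr_eq0// gt_eqF//.
by rewrite powR_gt0 ?normr_gt0.
Qed.

Definition lp_grad {R : realType} {n : nat} (p : R) (x : 'rV[R]_n) : 'rV[R]_n :=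
  \row_j abs_slope p (x 0 j).

(** The cone of the theorem, with the multiplier [l] kept visible: a vector with
    [l = 1] is a regular subgradient of the p-th power sum, one with [l = 0] is
    a horizon subgradient.  The last clause is the corner of the absolute value
    at [0]; for [p < 1] it is void. *)
Definition lp_multiplier {R : realType} {n : nat} (p : R) (x v : 'rV[R]_n)
    (l : R) :=
  [/\ 0 <= l,
      forall j, x 0 j != 0 -> v 0 j = l * abs_slope p (x 0 j) &
      p = 1 -> forall j, x 0 j = 0 -> `|v 0 j| <= l].

(** * Regular normals to the l_p ball *)

Section LpBall.
Set Implicit Arguments.
Unset Strict Implicit.
Variables (R : realType) (n : nat) (p : R).
Hypotheses (p_gt0 : 0 < p) (p_le1 : p <= 1).
Implicit Types (x v w : 'rV[R]_n) (l m : R).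

Lemma abs_slope0 : abs_slope p (0 : R) = 0.
Proof. by rewrite /abs_slope sgr0 !mul0r. Qed.

Lemma lp_powZ a x : lp_pow p (a *: x) = `|a| `^ p * lp_pow p x.
Proof.
by rewrite /lp_pow mulr_sumr; apply: eq_bigr => j _; rewrite mxE normrM powRM.
Qed.

Lemma lp_pow_continuous : continuous (lp_pow p : 'rV[R]_n -> R).
Proof.
apply: continuous_big => [|j _ x]; first exact: add_continuous.
apply: (@continuous_comp _ _ _ (fun x : 'rV[R]_n => x 0 j)
  (fun t : R => `|t| `^ p)).
  exact: coord_continuous.
exact: abs_powR_continuous.
Qed.

Lemma lp_pow_gt0 x : 0 < lp_pow p x -> exists j, x 0 j != 0.
Proof.
move=> x0; apply: contrapT => /forallNP H; move: x0.
rewrite /lp_pow big1 ?ltxx// => j _.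
by have /negP := H j; rewrite negbK => /eqP ->; rewrite normr0 powR0 ?gt_eqF.
Qed.

Lemma lp_multiplierZ x v l a : 0 <= a ->
  lp_multiplier p x v l -> lp_multiplier p x (a *: v) (a * l).
Proof.
move=> a0 [l0 vS v0]; split; first exact: mulr_ge0.
- by move=> j xj; rewrite mxE vS// mulrA.
- by move=> p1 j xj; rewrite mxE normrM ger0_norm// ler_wpM2l// v0.
Qed.

Lemma lp_multiplierD x v w l m :
  lp_multiplier p x v l -> lp_multiplier p x w m ->
  lp_multiplier p x (v + w) (l + m).
Proof.
move=> [l0 vS v0] [m0 wS w0]; split; first exact: addr_ge0.
- by move=> j xj; rewrite mxE vS// wS// mulrDl.
- move=> p1 j xj; rewrite mxE (le_trans (ler_normD _ _))// lerD ?v0 ?w0//.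
Qed.

Lemma lp_multiplier_grad x : lp_multiplier p x (lp_grad p x) 1.
Proof.
split=> // [j _|_ j xj]; first by rewrite mxE mul1r.
by rewrite mxE xj abs_slope0 normr0.
Qed.

(** The function is separable, so the scalar minorants add up.  The error
    [e] is shared equally between the coordinates; dividing by [n + 1] rather
    than [n] keeps the shares positive when [n = 0]. *)
Lemma lp_multiplier_regular_subdiff x v :
  lp_multiplier p x v 1 -> regular_subdiff (lp_pow p) x v.
Proof.
move=> [_ vS v0]; apply/regular_subdiffP => e e0.
have d0 : 0 < n%:R + 1 :> R by rewrite ltr_wpDl ?ler0n.
pose d := e / (n%:R + 1); have d_gt0 : 0 < d by rewrite divr_gt0.
have H j : \forall y \near x,
    `|x 0 j| `^ p + v 0 j * ((y : 'rV[R]_n) 0 j - x 0 j) <=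
    `|(y : 'rV[R]_n) 0 j| `^ p + d * `|y 0 j - x 0 j|.
  have yx : (y : 'rV[R]_n) 0 j @[y --> x] --> x 0 j by exact: coord_continuous.
  have [xj|xj] := eqVneq (x 0 j) 0.
    rewrite xj in yx *.
    have := abs_powR_lower0 p_gt0 p_le1 (fun p1 => v0 p1 _ xj).
    move=> /yx H; near=> y.
    have Hy : v 0 j * (y : 'rV[R]_n) 0 j <= `|y 0 j| `^ p by near: y; exact: H.
    rewrite subr0 normr0 powR0 ?gt_eqF// add0r (le_trans Hy)// lerDl.
    by rewrite mulr_ge0// ltW.
  have /yx H := abs_powR_lower p_gt0 p_le1 xj d_gt0.
  by rewrite vS// mul1r; exact: H.
have : \forall y \near x, forall j,
  `|x 0 j| `^ p + v 0 j * ((y : 'rV[R]_n) 0 j - x 0 j) <=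
    `|(y : 'rV[R]_n) 0 j| `^ p + d * `|y 0 j - x 0 j|.
  exact: (@filter_forall _ 'I_n _ (nbhs x) _ H).
apply: filterS => y yle.
have : \sum_(j < n) (`|x 0 j| `^ p + v 0 j * (y 0 j - x 0 j)) <=
       \sum_(j < n) (`|y 0 j| `^ p + d * `|y 0 j - x 0 j|).
  by apply: ler_sum => j _; exact: yle.
rewrite !big_split/= -mulr_sumr => le_sum.
have -> : dotp v (y - x) = \sum_(j < n) v 0 j * (y 0 j - x 0 j).
  by apply: eq_bigr => j _; rewrite !mxE.
apply: le_trans le_sum _; rewrite lerD2l.
have -> : \sum_(j < n) `|y 0 j - x 0 j| = \sum_(j < n) `|(y - x) 0 j|.
  by apply: eq_bigr => j _; rewrite !mxE.
apply: le_trans (ler_wpM2l (ltW d_gt0) (sum_coord_le_enorm _)) _.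
rewrite mulrA ler_wpM2r ?enorm_ge0// /d mulrAC ler_pdivrMr//.
by rewrite ler_wpM2l ?(ltW e0)// lerDl.
Unshelve. all: by end_near. Qed.

(** For [l > 0] the vector is [l] times a regular subgradient.  For [l = 0] it
    need not be such a multiple; but adding a small positive multiple of the
    gradient makes the multiplier positive, and the cone is closed. *)
Lemma lp_multiplier_regular_normal x v l :
  lp_multiplier p x v l -> regular_normal_cone (lp_ball p (lp_pow p x)) x v.
Proof.
move=> vl; have l0 : 0 <= l by case: vl.
apply: regular_normal_closed => e e0.
pose s := \sum_(i < n) `|lp_grad p x 0 i|.
have s0 : 0 < s + 1 by rewrite ltr_wpDl ?sumr_ge0.
pose d := e / (s + 1); have d0 : 0 < d by rewrite divr_gt0.
have ld : 0 < l + d by rewrite ltr_wpDl.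
exists (v + d *: lp_grad p x).
  have := lp_multiplierD vl (lp_multiplierZ (ltW d0) (lp_multiplier_grad x)).
  rewrite mulr1; set w := v + _ => wl.
  have w1 : lp_multiplier p x ((l + d)^-1 *: w) 1.
    rewrite -[X in lp_multiplier _ _ _ X](mulVf (lt0r_neq0 ld)).
    by apply: lp_multiplierZ => //; rewrite invr_ge0 ltW.
  rewrite -[w](scalerKV (lt0r_neq0 ld)).
  apply: (regular_normal_sublevel (ltW ld) erefl).
  exact: lp_multiplier_regular_subdiff.
move=> i; rewrite [(v + _) 0 i]mxE opprD addrA subrr sub0r normrN mxE normrM.
rewrite (ger0_norm (ltW d0)) /d mulrAC ler_pdivrMr// ler_wpM2l ?(ltW e0)//.
rewrite /s (bigD1 i)//= -addrA lerDl addr_ge0// sumr_ge0//.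
Qed.

(** Each term stays below its tangent along the ray: on the support because of
    concavity, off the support because either [w] does not move the coordinate
    or [p = 1] and the function is linear on each side of [0].  Concavity
    leaves no remainder, so a direction tangent to the level set is feasible. *)
Lemma lp_ball_feasible x w :
  (forall j, x 0 j = 0 -> p = 1 \/ w 0 j = 0) ->
  dotp (lp_grad p x) w + \sum_(j < n | x 0 j == 0) `|w 0 j| <= 0 ->
  \forall t \near 0^'+, lp_ball p (lp_pow p x) (x + t *: w).
Proof.
move=> w0 wle.
have H j : \forall t \near 0^'+, `|(x + t *: w) 0 j| `^ p <=
    `|x 0 j| `^ p + t * (lp_grad p x 0 j * w 0 j +
                         if x 0 j == 0 then `|w 0 j| else 0).
  have [xj|xj] := eqVneq (x 0 j) 0.
    near=> t; have t0 : 0 < t by near: t; exact: nbhs_right_gt.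
    rewrite !mxE xj abs_slope0 mul0r !add0r normr0 powR0 ?gt_eqF// add0r.
    have [p1|->] := w0 _ xj; last by rewrite mulr0 normr0 mulr0 powR0 ?gt_eqF.
    by rewrite p1 powRr1// normrM (gtr0_norm t0).
  have xt : (x + t *: w) 0 j @[t --> 0^'+] --> x 0 j.
    apply: (@cvg_comp _ _ _ (fun t => x + t *: w) (fun y : 'rV[R]_n => y 0 j)).
      exact: cvg_ray.
    exact: coord_continuous.
  have sgx := xt _ (sg_near xj).
  near=> t.
  have sgt : Num.sg ((x + t *: w) 0 j) = Num.sg (x 0 j).
    by near: t; exact: sgx.
  have := abs_powR_le_tangent p_gt0 p_le1 xj (t := (x + t *: w) 0 j).
  rewrite -sgt -normrEsg normr_ge0 => /(_ isT) /le_trans; apply.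
  rewrite lerD2l addr0 !mxE [x 0 j + _]addrC addrK mulrCA mulrA mulrC.
  by rewrite mulrC mulrCA.
have : \forall t \near 0^'+, forall j, `|(x + t *: w) 0 j| `^ p <=
    `|x 0 j| `^ p + t * (lp_grad p x 0 j * w 0 j +
                         if x 0 j == 0 then `|w 0 j| else 0).
  exact: (@filter_forall _ 'I_n _ (0^'+) _ H).
move=> {}H; near=> t.
have t0 : 0 < t by near: t; exact: nbhs_right_gt.
have Ht : forall j, `|(x + t *: w) 0 j| `^ p <=
    `|x 0 j| `^ p + t * (lp_grad p x 0 j * w 0 j +
                         if x 0 j == 0 then `|w 0 j| else 0) by near: t.
rewrite /lp_ball/=; apply: le_trans (ler_sum _ (fun j _ => Ht j)) _.
rewrite big_split/= gerDl -mulr_sumr pmulr_rle0// big_split/=.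
by rewrite -big_mkcond.
Unshelve. all: by end_near. Qed.

(** Farkas' lemma for a single inequality, with explicit test directions. *)
Lemma regular_normal_lp_multiplier x v : 0 < lp_pow p x ->
  regular_normal_cone (lp_ball p (lp_pow p x)) x v ->
  exists l, lp_multiplier p x v l.
Proof.
move=> /lp_pow_gt0[i xi] vN; set g := lp_grad p x.
have gg : 0 < dotp g g.
  rewrite lt_neqAle dotp_ge0 andbT eq_sym; apply/eqP => /dotp_eq0 /rowP /(_ i).
  by rewrite !mxE => /eqP; apply/negP; exact: abs_slope_neq0.
have feas w : (forall j, x 0 j = 0 -> p = 1 \/ w 0 j = 0) ->
    dotp g w + \sum_(j < n | x 0 j == 0) `|w 0 j| <= 0 -> dotp v w <= 0.
  move=> w0 wle; apply: (regular_normal_feasible vN).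
  exact: lp_ball_feasible.
have g0 j : x 0 j = 0 -> g 0 j = 0 by move=> xj; rewrite mxE xj abs_slope0.
have feas0 w : (forall j, x 0 j = 0 -> w 0 j = 0) ->
    dotp g w <= 0 -> dotp v w <= 0.
  move=> w0 gw; apply: feas => [j xj|]; first by right; exact: w0.
  by rewrite big1 ?addr0// => j /eqP xj; rewrite w0 ?normr0.
(* [l] is the coefficient of the projection of [v] on the line of [g]. *)
pose l := dotp v g / dotp g g.
exists l; split.
(* The direction [- g] shows that [l] is nonnegative. *)
- rewrite divr_ge0 ?dotp_ge0// -oppr_le0 -mulN1r -dotpZr; apply: feas0.
    by move=> j xj; rewrite mxE g0 ?mulr0.
  by rewrite dotpZr mulN1r oppr_le0 dotp_ge0.
(* [w] is the part of [v] on the support that is orthogonal to [g]; as a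
   direction it is feasible, and [dotp v w = dotp w w]. *)
- pose vS : 'rV[R]_n := \row_j (if x 0 j == 0 then 0 else v 0 j).
  pose w := vS - l *: g.
  have w0 j : x 0 j = 0 -> w 0 j = 0.
    move=> xj; rewrite /w mxE [vS 0 j]mxE xj eqxx mxE [(l *: g) 0 j]mxE.
    by rewrite g0// mulr0 subr0.
  have restr (u : 'rV[R]_n) :
      (forall j, x 0 j = 0 -> u 0 j = 0) -> dotp v u = dotp vS u.
    move=> u0; apply: eq_bigr => j _; rewrite [vS 0 j]mxE.
    by case: eqP => // /u0 ->; rewrite !mulr0.
  have gw : dotp g w = 0.
    rewrite /w -scaleNr dotpDr dotpZr dotpC -restr// /l mulNr divfK ?gt_eqF//.
    by rewrite subrr.
  have /dotp_eq0 w_eq0 : dotp w w = 0.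
    apply/le_anti; rewrite dotp_ge0 andbT {1}/w -scaleNr dotpDl dotpZl gw mulr0.
    by rewrite addr0 -restr// feas0// gw.
  move=> j xj; have := congr1 (fun u : 'rV[R]_n => u 0 j) w_eq0.
  by rewrite !mxE (negPf xj) => /eqP; rewrite subr_eq0 => /eqP.
(* Moving coordinate [j] away from [0] at unit speed raises the sum at rate 1,
   which the multiple of [- g] exactly compensates. *)
- move=> p1 j xj; pose c := Num.sg (v 0 j).
  have := feas (c *: delta_mx 0 j - (dotp g g)^-1 *: g).
  have deltaE (u : 'rV[R]_n) : dotp u (delta_mx 0 j) = u 0 j.
    rewrite /dotp (bigD1 j)//= mxE !eqxx mulr1 big1 ?addr0// => k kj.
    by rewrite mxE (negPf kj) andbF mulr0.
  rewrite -scaleNr !dotpDr !dotpZr !deltaE g0// mulr0 add0r.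
  rewrite mulNr mulVf ?gt_eqF// mulNr -normrEsg [_ * dotp v g]mulrC -/l.
  rewrite subr_le0; apply.
    by move=> k _; left.
  rewrite (bigD1 j)/= ?xj// big1 => [|k /andP[/eqP xk kj]]; last first.
    by rewrite !mxE xk abs_slope0 (negPf kj) andbF !mulr0 addr0 normr0.
  rewrite !mxE xj abs_slope0 !eqxx mulr0 mulr1 !addr0 normr_sg.
  by case: (v 0 j != 0); rewrite /=; lra.
Qed.

(** The cone depends on [x] in an outer semicontinuous way.  A coordinate [i] in
    the support of the limit determines the multiplier as the quotient [L] of
    the normal and the slope, so the multipliers converge; the support of
    [x_ k] eventually contains that of [x], and for [p = 1] a coordinate that
    vanishes only in the limit has a slope of absolute value 1. *)
Lemma lp_multiplier_closed x v (x_ v_ : nat -> 'rV[R]_n) :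
  (exists j, x 0 j != 0) ->
  x_ @ \oo --> x -> v_ @ \oo --> v ->
  (\forall k \near \oo, exists l, lp_multiplier p (x_ k) (v_ k) l) ->
  exists l, lp_multiplier p x v l.
Proof.
move=> [i xi] xx vv H.
have xc j : x_ k 0 j @[k --> \oo] --> x 0 j.
  apply: (@cvg_comp _ _ _ x_ (fun y : 'rV[R]_n => y 0 j) _ (nbhs x)) => //.
  exact: coord_continuous.
have vc j : v_ k 0 j @[k --> \oo] --> v 0 j.
  apply: (@cvg_comp _ _ _ v_ (fun y : 'rV[R]_n => y 0 j) _ (nbhs v)) => //.
  exact: coord_continuous.
have slope_c j : x 0 j != 0 ->
    abs_slope p (x_ k 0 j) @[k --> \oo] --> abs_slope p (x 0 j).
  move=> xj.
  apply: (@cvg_comp _ _ _ (fun k => x_ k 0 j) (abs_slope p) _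
    (nbhs (x 0 j))).
    exact: xc.
  exact: abs_slope_continuous.
have x_neq0 j : x 0 j != 0 -> \forall k \near \oo, x_ k 0 j != 0.
  move=> xj; near=> k; rewrite -sgr_eq0.
  have -> : Num.sg (x_ k 0 j) = Num.sg (x 0 j).
    by near: k; exact: (xc j _ (sg_near xj)).
  by rewrite sgr_eq0.
pose L k := v_ k 0 i / abs_slope p (x_ k 0 i).
pose l := v 0 i / abs_slope p (x 0 i).
have Lc : L k @[k --> \oo] --> l.
  by apply: cvgM => //; apply: cvgV; [exact: abs_slope_neq0|exact: slope_c].
have HL : \forall k \near \oo, lp_multiplier p (x_ k) (v_ k) (L k).
  near=> k; have xki : x_ k 0 i != 0 by near: k; exact: x_neq0.
  have [m vm] : exists m, lp_multiplier p (x_ k) (v_ k) m by near: k.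
  suff -> : L k = m by [].
  by case: vm => _ vS _; rewrite /L vS// mulfK// abs_slope_neq0.
exists l; split.
- apply: (ler_cvg_to (cvg_cst 0) Lc).
  by apply: filterS HL => k [].
- move=> j xj.
  have : L k * abs_slope p (x_ k 0 j) @[k --> \oo] --> l * abs_slope p (x 0 j).
    by apply: cvgM => //; exact: slope_c.
  move=> Lg; apply: (cvg_unique (@norm_hausdorff _ R) (vc j)).
  apply: cvg_trans Lg; apply: near_eq_cvg; near=> k.
  have [_ vS _] : lp_multiplier p (x_ k) (v_ k) (L k) by near: k.
  by rewrite vS//; near: k; exact: x_neq0.
- move=> p1 j xj; apply: (ler_cvg_to (cvg_norm (vc j)) Lc).
  apply: filterS HL => k [L0 vS v0].
  have [xkj|xkj] := eqVneq (x_ k 0 j) 0; first exact: v0.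
  rewrite vS// /abs_slope p1 subrr powRr0 !mulr1 normrM normr_sg xkj mulr1.
  by rewrite ger0_norm.
Unshelve. all: by end_near. Qed.

Lemma lp_ball_closed (theta : R) : closed (lp_ball p theta : set 'rV[R]_n).
Proof.
rewrite (_ : lp_ball p theta = lp_pow p @^-1` [set t : R | t <= theta])//.
by apply: closed_comp => [x _|]; [exact: lp_pow_continuous|exact: closed_le].
Qed.

(** By homogeneity, a point on the level [theta] leaves the ball when it is
    scaled up by any factor [1 + t > 1]. *)
Lemma lp_ball_interior (theta : R) x :
  0 < theta -> interior (lp_ball p theta) x <-> lp_pow p x < theta.
Proof.
move=> theta0; split=> [xI|xlt]; last first.
  have : \forall y \near x, lp_pow p y < theta.
    have /cvgr_lt := @lp_pow_continuous x; exact.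
  by apply: filterS => y /ltW.
rewrite lt_neqAle (interior_subset xI) andbT; apply/eqP => xE.
have /(_ _ xI) H := @cvg_ray R n x x.
have [t t0 /= tle] : exists2 t : R, 0 < t & lp_ball p theta (x + t *: x).
  near (0:R)^'+ => t; exists t; first by near: t; exact: nbhs_right_gt.
  by near: t; exact: H.
move: tle; rewrite /lp_ball/= -[x in x + _]scale1r -scalerDl lp_powZ xE.
rewrite leNgt ltr_pMl// => /negP; apply.
have t1 : 0 < 1 + t by lra.
have lt1 : 1 < 1 + t by lra.
rewrite gtr0_norm//.
have := gt0_ltr_powR p_gt0 (x := 1) (y := 1 + t).
by rewrite powR1; apply=> //; rewrite nnegrE ?ltW.
Unshelve. all: by end_near. Qed.

End LpBall.

(** * Normal cones and subdifferentials *)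

Section NormalCones.
Set Implicit Arguments.
Unset Strict Implicit.
Variables (R : realType) (n : nat) (p theta : R).
Hypotheses (p_gt0 : 0 < p) (p_le1 : p <= 1) (theta_gt0 : 0 < theta).
Implicit Types (x v : 'rV[R]_n).

Let Theta : set 'rV[R]_n := lp_ball p theta.

Lemma lp_ball_boundary x : boundary Theta x -> lp_pow p x = theta.
Proof.
move=> [/(lp_ball_closed p_gt0) xT xI]; apply/eqP.
rewrite eq_le xT leNgt; apply/negP => xlt; apply: xI.
exact/lp_ball_interior.
Qed.

Lemma lp_ball_regular_normalE x : lp_pow p x = theta ->
  regular_normal_cone Theta x = [set v | exists l, lp_multiplier p x v l].
Proof.
move=> xE; apply/seteqP; split=> v /=; rewrite /Theta -xE.
  by apply: regular_normal_lp_multiplier => //; rewrite xE.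
by move=> [l]; exact: lp_multiplier_regular_normal.
Qed.

Lemma lp_ball_normalE x : lp_pow p x = theta ->
  normal_cone Theta x = [set v | exists l, lp_multiplier p x v l].
Proof.
move=> xE; apply/seteqP.
split=> v /= => [[x_ [v_ [xT xx vN vv]]]|vl]; last first.
  apply: regular_normal_sub; first by rewrite /Theta/lp_ball/= xE.
  by rewrite lp_ball_regular_normalE.
apply: (lp_multiplier_closed p_gt0 _ xx vv).
  by apply: (lp_pow_gt0 p_gt0); rewrite xE.
apply: nearW => k; have := xT k; rewrite /Theta /lp_ball/= le_eqVlt.
move=> /predU1P[xkE|xklt].
  by have := vN k; rewrite lp_ball_regular_normalE.
exists 0; have -> : v_ k = 0.
  by apply: regular_normal_interior (vN k); exact/lp_ball_interior.
rewrite -(mul0r 1) -(scale0r (lp_grad p (x_ k))).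
by apply: lp_multiplierZ => //; exact: lp_multiplier_grad.
Qed.

Lemma lp_ball_normal_interior x : lp_pow p x < theta ->
  normal_cone Theta x = [set 0].
Proof.
move=> xlt; apply/seteqP.
split=> v /= => [[x_ [v_ [xT xx vN vv]]]|->]; last first.
  by apply: regular_normal_sub; [exact: ltW|exact: regular_normal0].
apply: (cvg_unique (@norm_hausdorff _ _) vv); apply: cvg_near_cst.
have xI : interior Theta x by exact/lp_ball_interior.
near=> k; apply: regular_normal_interior (vN k).
by near: k; apply: xx; exact: nbhs_interior.
Unshelve. all: by end_near. Qed.

Lemma lp_ball_clarke_regular x : Theta x -> clarke_regular Theta x.
Proof.
move=> xT; split.
  exists setT; split; [exact: filterT|exact: closedT|].
  by rewrite setIT; exact: lp_ball_closed.
move: (xT); rewrite /Theta/lp_ball/= le_eqVlt => /predU1P[xE|xlt].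
  by rewrite -/Theta lp_ball_normalE// lp_ball_regular_normalE.
rewrite -/Theta lp_ball_normal_interior//; apply/seteqP; split=> v /=.
  by move=> ->; exact: regular_normal0.
by apply: regular_normal_interior; exact/lp_ball_interior.
Qed.

(** A regular subgradient is normal to the ball of level [lp_pow p x], which has
    [x] on its boundary. *)
Lemma regular_subdiff_lp_multiplier x v : 0 < lp_pow p x ->
  regular_subdiff (lp_pow p) x v -> exists l, lp_multiplier p x v l.
Proof.
move=> x0 vS; apply: (regular_normal_lp_multiplier p_gt0 p_le1) => //.
by rewrite -[v]scale1r; exact: regular_normal_sublevel.
Qed.

Lemma lp_pow_subdiff_multiplier x v : 0 < lp_pow p x ->
  subdiff (lp_pow p) x v -> exists l, lp_multiplier p x v l.
Proof.
move=> x0 [x_ [v_ [xx phi_x vS vv]]].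
apply: (lp_multiplier_closed p_gt0 (lp_pow_gt0 p_gt0 x0) xx vv).
near=> k; apply: regular_subdiff_lp_multiplier (vS k).
by near: k; have /cvgr_gt := phi_x; apply.
Unshelve. all: by end_near. Qed.

Lemma lp_pow_horizon_multiplier x v : 0 < lp_pow p x ->
  horizon_subdiff (lp_pow p) x v -> exists l, lp_multiplier p x v l.
Proof.
move=> x0 [x_ [v_ [l_ [xx phi_x vS [l0 _] vv]]]].
apply: (lp_multiplier_closed p_gt0 (lp_pow_gt0 p_gt0 x0) xx vv).
near=> k; have [m vm] : exists m, lp_multiplier p (x_ k) (v_ k) m.
  apply: regular_subdiff_lp_multiplier (vS k).
  by near: k; have /cvgr_gt := phi_x; apply.
by exists (l_ k * m); apply: lp_multiplierZ => //; exact: ltW.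
Unshelve. all: by end_near. Qed.

(** Adding the gradient to arbitrarily large multiples of [v] gives vectors of
    multiplier 1, that is regular subgradients, at the point [x] itself. *)
Lemma lp_multiplier0_horizon x v :
  lp_multiplier p x v 0 -> horizon_subdiff (lp_pow p) x v.
Proof.
move=> v0; exists (fun=> x).
exists (fun k => lp_grad p x + (harmonic k)^-1 *: v), harmonic.
have harm0 k : 0 < harmonic k :> R by rewrite invr_gt0 ltr0n.
split; [exact: cvg_cst|exact: cvg_cst| | |].
- move=> k; apply: lp_multiplier_regular_subdiff => //.
  rewrite -[X in lp_multiplier _ _ _ X]addr0 -(mulr0 (harmonic k)^-1).
  apply: lp_multiplierD; first exact: lp_multiplier_grad.
  by apply: lp_multiplierZ => //; rewrite invr_ge0 ltW.
- by split=> //; exact: cvg_harmonic.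
- have : harmonic k *: lp_grad p x + v @[k --> \oo] --> 0 *: lp_grad p x + v.
    apply: cvgD; last exact: cvg_cst.
    by apply: cvgZr_tmp; exact: cvg_harmonic.
  rewrite scale0r add0r; apply: cvg_trans.
  apply: near_eq_cvg; apply: nearW => k.
  by rewrite scalerDr scalerA divff ?gt_eqF// scale1r.
Qed.

Lemma lp_multiplier_subgradient x : 0 < lp_pow p x ->
  [set v | exists l, lp_multiplier p x v l] =
  pos_hull (subdiff (lp_pow p) x) `|` horizon_subdiff (lp_pow p) x.
Proof.
move=> x0; apply/seteqP; split=> v /=.
  move=> [l vl]; have [l0 _ _] := vl; move: l0.
  rewrite le_eqVlt => /predU1P[lE|l0].
    by right; apply: lp_multiplier0_horizon; rewrite lE.
  left; right; exists l, (l^-1 *: v); split=> //; last first.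
    by rewrite scalerA divff ?scale1r ?gt_eqF.
  apply: regular_subdiff_sub; apply: lp_multiplier_regular_subdiff => //.
  rewrite -[X in lp_multiplier _ _ _ X](mulVf (lt0r_neq0 l0)).
  by apply: lp_multiplierZ => //; rewrite invr_ge0 ltW.
move=> [[->|[a [u [a0 uS ->]]]]|]; last exact: lp_pow_horizon_multiplier.
  exists 0; rewrite -(mul0r 1) -(scale0r (lp_grad p x)).
  by apply: lp_multiplierZ => //; exact: lp_multiplier_grad.
have [m um] := lp_pow_subdiff_multiplier x0 uS.
by exists (a * m); apply: lp_multiplierZ => //; exact: ltW.
Qed.

End NormalCones.

Theorem theorem2p2 (R : realType) (n : nat) (p theta : R)
  (p_gt0 : 0 < p) (p_le1 : p <= 1) (theta_gt0 : 0 < theta)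
  (xbar : 'rV[R]_n) (xbar_in : lp_ball p theta xbar) :
  let phi : 'rV[R]_n -> R := lp_pow p in
  let Theta : set 'rV[R]_n := lp_ball p theta in
  [/\ boundary Theta xbar ->
        normal_cone Theta xbar =
        pos_hull (subdiff phi xbar) `|` horizon_subdiff phi xbar,
      boundary Theta xbar -> p < 1 ->
        normal_cone Theta xbar =
        [set v : 'rV[R]_n | exists2 lambda : R, 0 <= lambda &
          forall j, xbar 0 j != 0 ->
            v 0 j = lambda * (Num.sg (xbar 0 j) * p *
                              `|xbar 0 j| `^ (p - 1))],
      boundary Theta xbar -> p = 1 ->
        normal_cone Theta xbar =
        [set v : 'rV[R]_n | exists2 lambda : R, 0 <= lambda &
          (forall j, xbar 0 j != 0 ->
             v 0 j = lambda * (Num.sg (xbar 0 j) * p *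
                               `|xbar 0 j| `^ (p - 1))) /\
          (forall j, xbar 0 j = 0 -> `|v 0 j| <= lambda)],
      interior Theta xbar -> normal_cone Theta xbar = [set 0] &
      clarke_regular Theta xbar].
Proof.
move=> phi Theta; split=> [xB|xB p1|xB p1|xI|].
- have xE := lp_ball_boundary p_gt0 theta_gt0 xB.
  rewrite lp_ball_normalE//; apply: lp_multiplier_subgradient => //.
  by rewrite xE.
- rewrite lp_ball_normalE//; last exact: lp_ball_boundary.
  apply/seteqP; split=> v /= [l].
    by move=> [l0 vS _]; exists l.
  by move=> l0 vS; exists l; split=> // pE; rewrite pE ltxx in p1.
- rewrite lp_ball_normalE//; last exact: lp_ball_boundary.
  apply/seteqP; split=> v /= [l].
    by move=> [l0 vS v0]; exists l => //; split=> //; exact: v0.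
  by move=> l0 [vS v0]; exists l; split.
- by apply: lp_ball_normal_interior => //; exact/lp_ball_interior.
- exact: lp_ball_clarke_regular.
Qed.
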